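(* Let $\triangle PQR$ be a (closed, filled) triangle in $D$ with $d'(P,R)=d'(Q,R)$, $d'(P,Q)>\log 9$ and $\delta(P,Q,R)>\frac{1}{2}\Delta_1'(P,Q)$. Then $\rho(\psi_{\triangle PQR})<\frac{2}{5}$.
   Context: $D$ is the open unit disk in $\mathbb R^2$, $S^1$ its boundary circle identified with $\mathbb R/\mathbb Z$ via the counterclockwise normalized angle. For a closed convex $U\subset D$ and $v\in S^1$, $\psi_U(v)$ is the point $w\in S^1\setminus\{v\}$ such that the line $vw$ meets $U$ and $U$ lies in the closed half-plane to the left of the directed line from $v$ to $w$; it is an orientation-preserving homeomorphism of $S^1$. For such $f$, $\rho(f)=\lim_{n\to\infty}(\overline f^n(x)-x)/n$ with $\overline f$ the lift to $\mathbb R$ satisfying $\overline f(0)\in[0,1)$. Regard $D$ as the Beltrami–Klein model (hyperbolic lines are chords). For distinct $P,Q\in D$ with chord endpoints $v_1,v_2\in S^1$, $d'(P,Q)=\tfrac12\left|\log\frac{|v_1Q||v_2P|}{|v_1P||v_2Q|}\right|$; $\Delta_n'(P,Q)=\log\frac{e^{n d'(P,Q)}+1}{e^{n d'(P,Q)}-1}$ for $n\in\mathbb Z_{>0}$; $\delta(P,Q,R)=\min\{d'(R,S): S \text{ on the chord through } P,Q\}$. *)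

(* Defs.v *)
From Stdlib Require Import Reals.
From Coquelicot Require Import Coquelicot.
Open Scope R_scope.

Definition pt := (R * R)%type.

Definition edist (A B : pt) : R :=
  sqrt ((fst A - fst B) ^ 2 + (snd A - snd B) ^ 2).

Definition in_D (A : pt) : Prop := fst A ^ 2 + snd A ^ 2 < 1.
Definition on_circle (A : pt) : Prop := fst A ^ 2 + snd A ^ 2 = 1.

Definition circ (t : R) : pt := (cos (2 * PI * t), sin (2 * PI * t)).

Definition lin (P Q : pt) (s : R) : pt :=
  (fst P + s * (fst Q - fst P), snd P + s * (snd Q - snd P)).

(* Parameters s of the two intersection points of the line PQ with the unit
   circle: roots of a s^2 + 2 b s + c = 0. *)
Definition ch_a (P Q : pt) : R := (fst Q - fst P) ^ 2 + (snd Q - snd P) ^ 2.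
Definition ch_b (P Q : pt) : R := fst P * (fst Q - fst P) + snd P * (snd Q - snd P).
Definition ch_c (P : pt) : R := fst P ^ 2 + snd P ^ 2 - 1.
Definition s_minus (P Q : pt) : R :=
  (- ch_b P Q - sqrt (ch_b P Q ^ 2 - ch_a P Q * ch_c P)) / ch_a P Q.
Definition s_plus (P Q : pt) : R :=
  (- ch_b P Q + sqrt (ch_b P Q ^ 2 - ch_a P Q * ch_c P)) / ch_a P Q.

Definition chord_end1 (P Q : pt) : pt := lin P Q (s_minus P Q).
Definition chord_end2 (P Q : pt) : pt := lin P Q (s_plus P Q).

Definition dprime_raw (P Q : pt) : R :=
  let v1 := chord_end1 P Q in
  let v2 := chord_end2 P Q in
  / 2 * Rabs (ln ((edist v1 Q * edist v2 P) / (edist v1 P * edist v2 Q))).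

Definition dprime (P Q : pt) : R :=
  match Req_EM_T (fst P) (fst Q), Req_EM_T (snd P) (snd Q) with
  | left _, left _ => 0
  | _, _ => dprime_raw P Q
  end.

Definition Deltap (n : nat) (P Q : pt) : R :=
  ln ((exp (INR n * dprime P Q) + 1) / (exp (INR n * dprime P Q) - 1)).

Definition on_chord (P Q S : pt) : Prop :=
  exists s, s_minus P Q < s < s_plus P Q /\ S = lin P Q s.

(* delta(P,Q,R) = min { d'(R,S) : S on the chord through P,Q } (taken as the
   infimum, which is attained). *)
Definition delta (P Q C : pt) : R :=
  real (Glb_Rbar (fun x => exists S, on_chord P Q S /\ x = dprime C S)).

Definition filled_triangle (P Q C : pt) (X : pt) : Prop :=
  exists a b c, 0 <= a /\ 0 <= b /\ 0 <= c /\ a + b + c = 1 /\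
    X = (a * fst P + b * fst Q + c * fst C, a * snd P + b * snd Q + c * snd C).

(* psi_U(v) = w: w on S^1, w <> v, the line vw meets U, and U lies in the
   closed half-plane to the left of the directed line from v to w. *)
Definition psi_rel (U : pt -> Prop) (v w : pt) : Prop :=
  on_circle w /\ w <> v /\
  (exists u t, U u /\ u = lin v w t) /\
  (forall u, U u ->
     0 <= (fst w - fst v) * (snd u - snd v) - (snd w - snd v) * (fst u - fst v)).

Definition is_lift_psi (U : pt -> Prop) (F : R -> R) : Prop :=
  continuity F /\ 0 <= F 0 < 1 /\
  forall x, psi_rel U (circ x) (circ (F x)).

(* rho = lim_n (F^n(x) - x)/n, evaluated at x = 0. *)
Definition rot_number (F : R -> R) : R :=
  real (Lim_seq (fun n => (Nat.iter n F 0 - 0) / INR n)).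

(* Main.v *)
Require Import Defs.
From Stdlib Require Import Reals Lra Lia Psatz ZArith.
From Coquelicot Require Import Coquelicot.
Open Scope R_scope.

(** In the half-angle vectors [(cos (PI x), sin (PI x))] the line through [circ x]
    and [circ y] passes through [A] iff a positive definite bilinear form [bform A]
    vanishes at [(x, y)], so [F x] is the smallest of the three angles in
    [(x, x + 1)] obtained by projecting [circ x] through a vertex.  Let [t] be a
    projective coordinate on the circle with [0] and infinity at the ends of the chord
    [PQ].  After rescaling [t], the projections through [P], [Q] and [C] read
    [t t' = - k], [k t t' = - 1] and [t t' + c (t + t') + 1 = 0]: the coefficients of
    the last one match because the triangle is isosceles.  Here [k = exp (- d'(P,Q))]
    and [tanh delta = |c|], so the hypotheses say [k < 1/9] and [k < |c|], and up to
    symmetry [c > 0].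

    For [t] in [(0, 1]] the projections in the order Q, C, P, Q, C (if [t <= 1/2]) or
    Q, C, P, C, P (if [t >= 1/2]) show [F^5 x < x + 2].  A periodic orbit with
    [F^5 x = x + 2] would have to enter this interval, so there is none, and by
    compactness [F^5 x <= x + 2 - eta] everywhere. *)

(** * Rotation numbers of circle lifts: a criterion for being below 2/5 *)

Section RotationNumber.

Variable F : R -> R.
Hypothesis Fcont : continuity F.
Hypothesis Fstep : forall x, x < F x < x + 1.
Hypothesis Fper : forall x, F (x + 1) = F x + 1.

Lemma lift_shift (m : Z) (x : R) : F (x + IZR m) = F x + IZR m.
Proof.
  assert (Hn : forall (n : nat) y, F (y + INR n) = F y + INR n).
  { induction n as [|n IH]; intros y.
    - simpl; now rewrite !Rplus_0_r.
    - rewrite S_INR, <- !Rplus_assoc, Fper, IH; reflexivity. }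
  destruct (Z_le_gt_dec 0 m) as [Hm | Hm].
  - rewrite <- (Z2Nat.id m Hm), <- INR_IZR_INZ; apply Hn.
  - pose proof (Hn (Z.to_nat (- m)) (x + IZR m)) as H.
    rewrite INR_IZR_INZ, Z2Nat.id, opp_IZR in H by lia.
    replace (x + IZR m + - IZR m) with x in H by ring; lra.
Qed.

Lemma iter_shift (n : nat) (m : Z) (x : R) :
  Nat.iter n F (x + IZR m) = Nat.iter n F x + IZR m.
Proof.
  induction n as [|n IH]; simpl; [reflexivity|].
  now rewrite IH, lift_shift.
Qed.

Lemma iter_continuity (n : nat) : continuity (Nat.iter n F).
Proof.
  induction n as [|n IH].
  - exact (derivable_continuous _ derivable_id).
  - exact (continuity_comp _ _ IH Fcont).
Qed.

Lemma iter_bounds (n : nat) (x : R) :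
  x <= Nat.iter n F x <= x + INR n.
Proof.
  induction n as [|n IH]; [simpl; lra|].
  rewrite S_INR; simpl Nat.iter.
  pose proof (Fstep (Nat.iter n F x)); lra.
Qed.

Lemma integer_translate (x : R) : exists m : Z, x <= IZR m < x + 1.
Proof.
  exists (- (up (- x) - 1))%Z.
  destruct (archimed (- x)) as [H1 H2].
  rewrite opp_IZR, minus_IZR; lra.
Qed.

Lemma rot_number_le (eta : R) :
  0 < eta < 2 -> (forall x, Nat.iter 5 F x <= x + 2 - eta) ->
  rot_number F <= (2 - eta) / 5.
Proof.
  intros Heta H5.
  set (r := (2 - eta) / 5).
  (* The constant 5 covers the iterates with [n < 5]; the strong induction then removes five
     iterates at a time. *)
  assert (Hgrow : forall n, Nat.iter n F 0 <= r * INR n + 5).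
  { intros n.
    induction n as [n IH] using (well_founded_induction lt_wf).
    destruct (le_lt_dec 5 n) as [Hn | Hn].
    - replace n with (5 + (n - 5))%nat by lia.
      rewrite Nat.iter_add, plus_INR.
      pose proof (H5 (Nat.iter (n - 5) F 0)) as Ha.
      pose proof (IH (n - 5)%nat ltac:(lia)) as Hb.
      replace (INR 5) with 5 by (simpl; ring).
      assert (r * 5 = 2 - eta) by (unfold r; field).
      lra.
    - pose proof (iter_bounds n 0) as Ha.
      assert (INR n <= 5) by (replace 5 with (INR 5) by (simpl; ring); apply le_INR; lia).
      assert (0 <= r * INR n) by (apply Rmult_le_pos; [unfold r; lra | apply pos_INR]).
      lra. }
  assert (Hup : Rbar_le (Lim_seq (fun n => (Nat.iter n F 0 - 0) / INR n)) r).
  { assert (Hl : is_lim_seq (fun n => r + 5 / INR n) r).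
    { apply is_lim_seq_ext with (fun n => r + 5 * / INR n); [reflexivity|].
      replace (Finite r) with (Rbar_plus r (Rbar_mult 5 0)) by (simpl; f_equal; ring).
      apply is_lim_seq_plus'; [apply is_lim_seq_const|].
      replace (5 * 0) with 0 by ring.
      replace (Finite 0) with (Rbar_mult 5 0) by (simpl; f_equal; ring).
      apply is_lim_seq_scal_l.
      replace (Finite 0) with (Rbar_inv p_infty) by reflexivity.
      apply is_lim_seq_inv; [apply is_lim_seq_INR | easy]. }
    rewrite <- (is_lim_seq_unique _ _ Hl).
    apply Lim_seq_le_loc; exists 1%nat; intros n Hn.
    assert (0 < INR n) by (apply lt_0_INR; lia).
    apply Rmult_le_reg_r with (INR n); [assumption|].
    replace ((Nat.iter n F 0 - 0) / INR n * INR n) with (Nat.iter n F 0) by (field; lra).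
    replace ((r + 5 / INR n) * INR n) with (r * INR n + 5) by (field; lra).
    apply Hgrow. }
  (* Together with [Hup] this makes the limit finite, so that [real] returns its value and not the
     default [0] at infinity. *)
  assert (Hlow : Rbar_le 0 (Lim_seq (fun n => (Nat.iter n F 0 - 0) / INR n))).
  { rewrite <- (Lim_seq_const 0).
    apply Lim_seq_le_loc; exists 1%nat; intros n Hn.
    apply Rdiv_le_0_compat; [| apply lt_0_INR; lia].
    pose proof (iter_bounds n 0); lra. }
  unfold rot_number.
  destruct (Lim_seq _) as [l | |]; simpl in *; easy.
Qed.

Lemma iter5_cont x : continuity_pt (fun y => Nat.iter 5 F y - y - 2) x.
Proof.
  apply continuity_pt_minus; [apply continuity_pt_minus|].
  - apply iter_continuity.
  - apply derivable_continuous, derivable_id.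
  - apply derivable_continuous, derivable_const.
Qed.

Variables a z : R.
Hypothesis Haz : a < z.
Hypothesis Hfall : forall x, a < x <= z -> Nat.iter 5 F x < x + 2.
Hypothesis Hhit : forall x, x <= a -> Nat.iter 3 F x <= z + 1.

(* On a 5-periodic orbit of rotation number 2/5 the map [F^3 - 1] moves every
   point to its right neighbour, and by [Hhit] it cannot jump over [(a, z]]. *)
Lemma no_periodic_orbit (x : R) : Nat.iter 5 F x <> x + 2.
Proof.
  intros Hx.
  destruct (integer_translate (x - a)) as [m Hm].
  assert (Hstay : forall j u, Nat.iter 5 F u = u + 2 -> u <= a + IZR m + INR j ->
            Nat.iter 3 F u <= a + IZR m + INR j + 1).
  { intros j u Hu Hle.
    (* By [Hhit], landing beyond the translate of [a] means landing in a translate of [(a, z]];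
       there [Hfall] contradicts the periodicity of [w]. *)
    apply Rnot_lt_le; intros Hlt.
    set (M := (m + Z.of_nat j)%Z).
    assert (HM : IZR M = IZR m + INR j) by (unfold M; rewrite plus_IZR, <- INR_IZR_INZ; reflexivity).
    pose proof (Hhit (u + IZR (- M))) as H3.
    rewrite iter_shift, opp_IZR in H3.
    specialize (H3 ltac:(lra)).
    set (w := Nat.iter 3 F u) in *.
    pose proof (Hfall (w + IZR (- M - 1))) as H5.
    rewrite iter_shift, minus_IZR, opp_IZR in H5.
    specialize (H5 ltac:(lra)).
    assert (Hw : Nat.iter 5 F w = w + 2).
    { unfold w; rewrite <- Nat.iter_add, (Nat.add_comm 5 3), Nat.iter_add, Hu.
      exact (iter_shift 3 2 u). }
    lra. }
  assert (Hper : forall n, Nat.iter 5 F (Nat.iter n F x) = Nat.iter n F x + 2).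
  { intros n; rewrite <- Nat.iter_add, Nat.add_comm, Nat.iter_add, Hx.
    exact (iter_shift n 2 x). }
  assert (Hall : forall j, Nat.iter (3 * j) F x <= a + IZR m + INR j).
  { induction j as [|j IH]; [simpl; lra|].
    replace (3 * S j)%nat with (3 + 3 * j)%nat by lia.
    rewrite Nat.iter_add, S_INR.
    specialize (Hstay j _ (Hper _) IH); lra. }
  (* Fifteen iterates move [x] by exactly 6, so [x <= a + IZR m - 1], against the choice of [m] as
     the ceiling of [x - a]. *)
  specialize (Hall 5%nat).
  change (3 * 5)%nat with (5 + (5 + 5))%nat in Hall.
  rewrite Nat.iter_add, Hper, Nat.iter_add, Hper, Hx in Hall.
  simpl INR in Hall; lra.
Qed.

(** The displacement [F^5 y - y - 2] is continuous, has no zero and is negative at [z], hence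
    negative everywhere; being 1-periodic, it attains a negative maximum, which is [- eta]. *)
Lemma rot_number_lt : rot_number F < 2 / 5.
Proof.
  assert (Hneg : forall x, Nat.iter 5 F x - x - 2 < 0).
  { intros x.
    apply Rnot_le_lt; intros Hx.
    pose proof (Hfall z ltac:(lra)) as Hz.
    set (g := fun y => Nat.iter 5 F y - y - 2) in *.
    assert (Hg : forall u v, g u * g v <= 0 -> False).
    { assert (Hlt : forall u v, u < v -> g u * g v <= 0 -> False).
      { intros u v Huv Hs.
        destruct (IVT_cor g u v) as [w [_ Hw]]; try lra.
        - intros y; apply iter5_cont.
        - apply (no_periodic_orbit w); unfold g in Hw; lra. }
      intros u v Hs.
      destruct (Rtotal_order u v) as [H | [H | H]].
      - now apply (Hlt u v).
      - subst v. apply (no_periodic_orbit u); unfold g in Hs; nra.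
      - apply (Hlt v u); [assumption | now rewrite Rmult_comm]. }
    apply (Hg x z).
    change (0 <= g x) in Hx.
    assert (g z < 0) by (unfold g; lra); nra. }
  destruct (continuity_ab_maj (fun y => Nat.iter 5 F y - y - 2) 0 1) as [y [Hy _]]; [lra | |].
  { intros; apply iter5_cont. }
  set (eta := - (Nat.iter 5 F y - y - 2)).
  pose proof (Hneg y) as Hny.
  assert (Heta : forall x, Nat.iter 5 F x <= x + 2 - eta).
  { intros x.
    destruct (integer_translate (- x)) as [m Hm].
    specialize (Hy (x + IZR m) ltac:(lra)); simpl in Hy.
    pose proof (iter_shift 5 m x) as Hs; simpl in Hs.
    unfold eta; simpl; lra. }
  assert (Hb : 0 < eta < 2).
  { split; [unfold eta; lra|].
    pose proof (Heta 0); pose proof (iter_bounds 4 (F 0)).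
    pose proof (Fstep 0).
    rewrite <- Nat.iter_succ_r in H0; lra. }
  pose proof (rot_number_le eta Hb Heta); lra.
Qed.

End RotationNumber.

(** * Points of the disk as positive definite forms on half-angle vectors *)

(* The symmetric bilinear form attached to [A], on the half-angle vectors
   [(cos (PI x), sin (PI x))]: it vanishes at [(x, y)] iff [A] is on the line
   through [circ x] and [circ y]. *)
Definition bform (A : pt) (x y : R) : R :=
  (1 - fst A) * (cos (PI * x) * cos (PI * y))
  + (1 + fst A) * (sin (PI * x) * sin (PI * y))
  - snd A * (cos (PI * x) * sin (PI * y) + sin (PI * x) * cos (PI * y)).

Lemma sin_pi_minus x y :
  sin (PI * (x - y)) = sin (PI * x) * cos (PI * y) - cos (PI * x) * sin (PI * y).
Proof. rewrite Rmult_minus_distr_l; apply sin_minus. Qed.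

Lemma cos_sin_pi_sqr x : cos (PI * x) * cos (PI * x) = 1 - sin (PI * x) * sin (PI * x).
Proof. pose proof (sin2_cos2 (PI * x)) as H; unfold Rsqr in H; lra. Qed.

Lemma sin_pi_pos x : 0 < x < 1 -> 0 < sin (PI * x).
Proof.
  intros Hx; pose proof PI_RGT_0.
  apply sin_gt_0; nra.
Qed.

Lemma circ_half_angle x :
  circ x = (1 - 2 * (sin (PI * x) * sin (PI * x)), 2 * (sin (PI * x) * cos (PI * x))).
Proof.
  unfold circ; replace (2 * PI * x) with (2 * (PI * x)) by ring.
  rewrite cos_2a_sin, sin_2a; f_equal; ring.
Qed.

Lemma bform_sym A x y : bform A x y = bform A y x.
Proof. unfold bform; ring. Qed.

(** Three vectors of the plane are linearly dependent, and for the half-angle vectors at [x], [y],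
    [z] the coefficients are these sines. *)
Lemma bform_interp A u x y z :
  sin (PI * (z - x)) * bform A u y =
  sin (PI * (z - y)) * bform A u x + sin (PI * (y - x)) * bform A u z.
Proof. rewrite !sin_pi_minus; unfold bform; ring. Qed.

Lemma bform_diag_pos A x : in_D A -> 0 < bform A x x.
Proof.
  unfold in_D, bform; destruct A as [a b]; simpl fst; simpl snd; intros HA.
  pose proof (cos_sin_pi_sqr x) as H.
  set (c := cos (PI * x)) in *; set (s := sin (PI * x)) in *.
  assert (0 < 1 - a) by nra.
  apply Rmult_lt_reg_l with (1 - a); [assumption|].
  rewrite Rmult_0_r.
  (* Completing the square; [1 - |A|^2] is the determinant of the form. *)
  enough (0 < ((1 - a) * c - b * s) ^ 2 + (1 - (a ^ 2 + b ^ 2)) * (s * s)) by nra.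
  pose proof (pow2_ge_0 ((1 - a) * c - b * s)).
  destruct (Req_dec s 0) as [Hs | Hs].
  - rewrite Hs in *; nra.
  - assert (0 < s * s) by (apply Rsqr_pos_lt; assumption); nra.
Qed.

Lemma bform_shift A x y : bform A (x + 1) (y + 1) = bform A x y.
Proof.
  unfold bform; rewrite !Rmult_plus_distr_l, !Rmult_1_r, !neg_cos, !neg_sin; ring.
Qed.

(** For [x < y < x + 1] the sine is positive, so the half-plane condition of [psi_rel] becomes
    nonnegativity of the form. *)
Lemma orientation_bform A x y :
  (fst (circ y) - fst (circ x)) * (snd A - snd (circ x))
  - (snd (circ y) - snd (circ x)) * (fst A - fst (circ x))
  = 2 * sin (PI * (y - x)) * bform A x y.
Proof.
  rewrite !circ_half_angle, sin_pi_minus; unfold bform; destruct A as [a b]; simpl.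
  pose proof (cos_sin_pi_sqr x) as Hx; pose proof (cos_sin_pi_sqr y) as Hy.
  set (cx := cos (PI * x)) in *; set (sx := sin (PI * x)) in *.
  set (cy := cos (PI * y)) in *; set (sy := sin (PI * y)) in *.
  symmetry.
  transitivity (2 * ((1 - a) * (sy * cy * (cx * cx) - sx * cx * (cy * cy))
     + (1 + a) * (sx * cx * (sy * sy) - sy * cy * (sx * sx))
     - b * ((cx * cx) * (sy * sy) - (sx * sx) * (cy * cy)))); [ring|].
  rewrite Hx, Hy; ring.
Qed.

Lemma bform_lt_between A x y z :
  in_D A -> x < y < z -> z < x + 1 -> 0 <= bform A x z -> 0 < bform A x y.
Proof.
  intros HA Hxyz Hz H.
  pose proof (bform_interp A x x y z) as E.
  pose proof (bform_diag_pos A x HA).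
  pose proof (sin_pi_pos (z - x) ltac:(lra)).
  pose proof (sin_pi_pos (z - y) ltac:(lra)).
  pose proof (sin_pi_pos (y - x) ltac:(lra)).
  apply Rmult_lt_reg_l with (sin (PI * (z - x))); [assumption|].
  rewrite E, Rmult_0_r; nra.
Qed.

(** Projection through [A] is monotone: [y] has not passed the projection of [x], while [y'] has
    reached that of [x']. *)
Lemma bform_compare A x y x' y' :
  in_D A -> x <= x' -> x' < y' -> x < y < x + 1 ->
  0 <= bform A x y -> bform A x' y' <= 0 -> y <= y'.
Proof.
  intros HA Hx Hy' Hy Hp Hn.
  apply Rnot_lt_le; intros Hlt.
  assert (H1 : 0 < bform A x y') by (apply (bform_lt_between A x y' y); auto; lra).
  destruct (Req_dec x x') as [<- | Hne]; [lra|].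
  pose proof (bform_interp A y' x x' y') as E.
  pose proof (bform_diag_pos A y' HA).
  pose proof (sin_pi_pos (y' - x) ltac:(lra)).
  pose proof (sin_pi_pos (y' - x') ltac:(lra)).
  pose proof (sin_pi_pos (x' - x) ltac:(lra)).
  rewrite (bform_sym A y' x'), (bform_sym A y' x) in E; nra.
Qed.

(** Change of basis to the half-angle vectors at [e1] and [e2], whose coefficients come from the
    sine relation of [bform_interp]. *)
Lemma bform_basis A e1 e2 x y :
  sin (PI * (e2 - e1)) ^ 2 * bform A x y =
  bform A e2 e2 * (sin (PI * (x - e1)) * sin (PI * (y - e1)))
  - bform A e1 e2 * (sin (PI * (x - e1)) * sin (PI * (y - e2))
                     + sin (PI * (x - e2)) * sin (PI * (y - e1)))
  + bform A e1 e1 * (sin (PI * (x - e2)) * sin (PI * (y - e2))).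
Proof. rewrite !sin_pi_minus; unfold bform; ring. Qed.

(** The determinant is a quadratic form on symmetric matrices, here the Lorentz form [1 - |A|^2].
    This is its polarization; the squared sine comes from the change of basis. It turns distances
    into relations between coefficients. *)
Lemma bform_polar A B e1 e2 :
  bform A e2 e2 * bform B e1 e1 + bform A e1 e1 * bform B e2 e2
  - 2 * (bform A e1 e2 * bform B e1 e2)
  = 2 * (sin (PI * (e2 - e1)) ^ 2 * (1 - (fst A * fst B + snd A * snd B))).
Proof. rewrite !sin_pi_minus; unfold bform; ring. Qed.

Lemma bform_det A e1 e2 :
  bform A e2 e2 * bform A e1 e1 - bform A e1 e2 ^ 2
  = sin (PI * (e2 - e1)) ^ 2 * (1 - (fst A ^ 2 + snd A ^ 2)).
Proof. rewrite !sin_pi_minus; unfold bform; ring. Qed.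

(** * Lifts of psi expressed through the forms of the vertices *)

Definition supports (F : R -> R) (A : pt) : Prop := forall x, 0 <= bform A x (F x).

Lemma circ_integer x (m : Z) : circ (x + IZR m) = circ x.
Proof.
  assert (Hn : forall (n : nat) y, circ (y + INR n) = circ y).
  { intros n y; unfold circ.
    replace (2 * PI * (y + INR n)) with (2 * PI * y + 2 * INR n * PI) by ring.
    now rewrite cos_period, sin_period. }
  destruct (Z_le_gt_dec 0 m) as [Hm | Hm].
  - rewrite <- (Z2Nat.id m Hm), <- INR_IZR_INZ; apply Hn.
  - rewrite <- (Hn (Z.to_nat (- m)) (x + IZR m)), INR_IZR_INZ, Z2Nat.id, opp_IZR by lia.
    f_equal; ring.
Qed.

Section Lift.

Variables (P Q C : pt) (F : R -> R).
Hypotheses (HP : in_D P) (HQ : in_D Q) (HC : in_D C).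
Hypothesis HF : is_lift_psi (filled_triangle P Q C) F.

Lemma lift_not_integer x (m : Z) : F x <> x + IZR m.
Proof.
  intros H; destruct HF as [_ [_ Hpsi]]; destruct (Hpsi x) as [_ [Hne _]].
  apply Hne; rewrite H; apply circ_integer.
Qed.

(** [F x - x] is continuous and never an integer, because [psi_rel] excludes [w = v]; it stays in
    the unit interval that holds its value at [0]. *)
Lemma lift_step x : x < F x < x + 1.
Proof.
  destruct HF as [Hc [H0 _]].
  assert (Hcont : forall c, continuity (fun y => F y - y - c)).
  { intros c y; apply continuity_pt_minus; [apply continuity_pt_minus|].
    - apply Hc.
    - apply derivable_continuous, derivable_id.
    - apply derivable_continuous, derivable_const. }
  assert (Hsign : forall m : Z, (F 0 - 0 - IZR m) * (F x - x - IZR m) > 0).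
  { intros m.
    apply Rnot_le_gt; intros Hle.
    destruct (Rtotal_order 0 x) as [H | [H | H]].
    - destruct (IVT_cor (fun y => F y - y - IZR m) 0 x (Hcont _)) as [w [_ Hw]]; try lra.
      apply (lift_not_integer w m); lra.
    - subst x; apply (lift_not_integer 0 m); nra.
    - destruct (IVT_cor (fun y => F y - y - IZR m) x 0 (Hcont _)) as [w [_ Hw]]; try lra.
      apply (lift_not_integer w m); lra. }
  pose proof (Hsign 0%Z) as Ha; pose proof (Hsign 1%Z) as Hb; simpl in Ha, Hb.
  assert (F 0 <> 0) by (pose proof (lift_not_integer 0 0); simpl in *; lra).
  split; nra.
Qed.

Lemma bform_affine A B D a b c x y : a + b + c = 1 ->
  bform (a * fst A + b * fst B + c * fst D, a * snd A + b * snd B + c * snd D) x y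
  = a * bform A x y + b * bform B x y + c * bform D x y.
Proof.
  intros H; unfold bform; simpl.
  replace c with (1 - a - b) by lra; ring.
Qed.

Lemma lift_supports_filled A : filled_triangle P Q C A -> supports F A.
Proof.
  intros HA x; destruct HF as [_ [_ Hpsi]]; destruct (Hpsi x) as [_ [_ [_ Hl]]].
  specialize (Hl A HA); rewrite orientation_bform in Hl.
  pose proof (lift_step x).
  pose proof (sin_pi_pos (F x - x) ltac:(lra)); nra.
Qed.

Lemma lift_supports : supports F P /\ supports F Q /\ supports F C.
Proof.
  repeat split; apply lift_supports_filled.
  - exists 1, 0, 0; repeat split; try lra; apply injective_projections; simpl; ring.
  - exists 0, 1, 0; repeat split; try lra; apply injective_projections; simpl; ring.
  - exists 0, 0, 1; repeat split; try lra; apply injective_projections; simpl; ring.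
Qed.

(** The form is affine in the point. At a touching point it vanishes and is a convex combination of
    three nonnegative vertex values, so a vertex of positive weight has value zero. *)
Lemma lift_touches x :
  bform P x (F x) = 0 \/ bform Q x (F x) = 0 \/ bform C x (F x) = 0.
Proof.
  destruct lift_supports as [H1 [H2 H3]].
  specialize (H1 x); specialize (H2 x); specialize (H3 x).
  destruct HF as [_ [_ Hpsi]]; destruct (Hpsi x) as [_ [_ [[u [t [Hu Ht]]] _]]].
  pose proof (orientation_bform u x (F x)) as E.
  pose proof (lift_step x).
  pose proof (sin_pi_pos (F x - x) ltac:(lra)).
  (* A point [lin v w t] of the line has zero cross product. *)
  assert (Hz : bform u x (F x) = 0).
  { rewrite Ht in E at 1 2; unfold lin in E; simpl fst in E; simpl snd in E; nra. }
  destruct Hu as [a [b [c [Ha [Hb [Hc [Hs Hu]]]]]]].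
  rewrite Hu, bform_affine in Hz by assumption.
  assert (a > 0 \/ b > 0 \/ c > 0) as [H4 | [H4 | H4]] by lra.
  - left; nra.
  - right; left; nra.
  - right; right; nra.
Qed.

(** [F x] is the first zero after [x] among the three forms, and shifting both arguments by 1 leaves
    each form unchanged. *)
Lemma lift_periodic x : F (x + 1) = F x + 1.
Proof.
  destruct lift_supports as [H1 [H2 H3]].
  pose proof (lift_step x); pose proof (lift_step (x + 1)).
  assert (Hle : forall A x y y', in_D A -> x < y < x + 1 -> x < y' ->
            0 <= bform A x y -> bform A x y' = 0 -> y <= y').
  { intros A u y y' HA ? ? ? ?; apply (bform_compare A u y u y'); auto; lra. }
  assert (Hs : forall A, bform A x (F (x + 1) - 1) = bform A (x + 1) (F (x + 1))).
  { intros A; rewrite <- bform_shift; f_equal; ring. }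
  apply Rle_antisym.
  - destruct (lift_touches x) as [E | [E | E]];
      [specialize (Hle P) | specialize (Hle Q) | specialize (Hle C)];
      specialize (Hle x (F (x + 1) - 1) (F x)); rewrite Hs in Hle;
      enough (F (x + 1) - 1 <= F x) by lra; apply Hle; try lra; try assumption; auto.
  - destruct (lift_touches (x + 1)) as [E | [E | E]];
      [specialize (Hle P) | specialize (Hle Q) | specialize (Hle C)];
      specialize (Hle x (F x) (F (x + 1) - 1)); rewrite Hs in Hle;
      enough (F x <= F (x + 1) - 1) by lra; apply Hle; try lra; try assumption; auto.
Qed.

End Lift.

(** * A projective coordinate with [0] and infinity at the ends of a chord *)

Section ChordCoordinate.

Variables e1 e2 mu : R.
Hypothesis He : e1 < e2 < e1 + 1.
Hypothesis Hmu : 0 < mu.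

(* The angle [x] in [(e2 - 1, e2)] with
   [- mu * sin (PI * (x - e1)) / sin (PI * (x - e2)) = t]. *)
Definition angle_of (t : R) : R :=
  e2 - / 2
  + atan ((t / mu + cos (PI * (e2 - e1))) / sin (PI * (e2 - e1))) / PI.

Lemma angle_of_lt t t' : t < t' -> angle_of t < angle_of t'.
Proof.
  intros H; unfold angle_of.
  pose proof (sin_pi_pos (e2 - e1) ltac:(lra)).
  pose proof PI_RGT_0.
  apply Rplus_lt_compat_l, Rmult_lt_compat_r; [now apply Rinv_0_lt_compat|].
  apply atan_increasing, Rmult_lt_compat_r; [now apply Rinv_0_lt_compat|].
  apply Rplus_lt_compat_r, Rmult_lt_compat_r; [now apply Rinv_0_lt_compat|assumption].
Qed.

Lemma angle_of_range t : e2 - 1 < angle_of t < e2.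
Proof.
  unfold angle_of; set (u := _ / sin _).
  pose proof (atan_bound u); pose proof PI_RGT_0.
  assert (atan u / PI < / 2 /\ - / 2 < atan u / PI); [split|lra].
  - apply Rmult_lt_reg_r with PI; [assumption|].
    unfold Rdiv; rewrite Rmult_assoc, Rinv_l by lra; lra.
  - apply Rmult_lt_reg_r with PI; [assumption|].
    unfold Rdiv; rewrite Rmult_assoc, Rinv_l by lra; lra.
Qed.

(** Up to the positive factor [r], these are the coordinates of the half-angle vector at
    [angle_of t] in the basis of [bform_basis]; they turn each form into a polynomial in [t] and
    [t']. *)
Lemma angle_of_sin t : exists r, 0 < r /\
  sin (PI * (angle_of t - e2)) = - r /\ sin (PI * (angle_of t - e1)) = r * (t / mu).
Proof.
  pose proof (sin_pi_pos (e2 - e1) ltac:(lra)) as Hs.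
  pose proof PI_RGT_0.
  unfold angle_of; set (u := _ / sin _).
  assert (Hu : u * sin (PI * (e2 - e1)) = t / mu + cos (PI * (e2 - e1)))
    by (unfold u; field; lra).
  pose proof (atan_bound u).
  assert (Hc : 0 < cos (atan u)) by (apply cos_gt_0; lra).
  assert (Ht : sin (atan u) = u * cos (atan u)).
  { rewrite <- (tan_atan u) at 2; unfold tan; field; lra. }
  exists (cos (atan u)); split; [assumption|split].
  - replace (PI * (e2 - / 2 + atan u / PI - e2)) with (- (PI / 2 - atan u)) by (field; lra).
    now rewrite sin_neg, sin_shift.
  - replace (PI * (e2 - / 2 + atan u / PI - e1))
      with (- (PI / 2 - (atan u + PI * (e2 - e1)))) by (field; lra).
    rewrite sin_neg, sin_shift, cos_plus, Ht.
    transitivity (cos (atan u) * (u * sin (PI * (e2 - e1)) - cos (PI * (e2 - e1)))); [ring|].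
    rewrite Hu; ring.
Qed.

Lemma angle_of_surj x : e2 - 1 < x < e2 -> exists t, x = angle_of t.
Proof.
  intros Hx.
  pose proof (sin_pi_pos (e2 - e1) ltac:(lra)) as Hs.
  pose proof PI_RGT_0.
  set (y := PI * (x - e2 + / 2)).
  exists (mu * (tan y * sin (PI * (e2 - e1)) - cos (PI * (e2 - e1)))).
  unfold angle_of; set (u := _ / sin _).
  replace u with (tan y) by (unfold u; field; lra).
  rewrite atan_tan by (unfold y; split; nra).
  unfold y; field; lra.
Qed.

Lemma bform_angle_of A t t' :
  bform A e2 e2 * (t * t') + mu * bform A e1 e2 * (t + t') + mu ^ 2 * bform A e1 e1 = 0 ->
  bform A (angle_of t) (angle_of t') = 0.
Proof.
  intros H.
  pose proof (sin_pi_pos (e2 - e1) ltac:(lra)) as Hs.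
  pose proof (bform_basis A e1 e2 (angle_of t) (angle_of t')) as E.
  destruct (angle_of_sin t) as [r [Hr [E1 E2]]].
  destruct (angle_of_sin t') as [r' [Hr' [E1' E2']]].
  rewrite E1, E2, E1', E2' in E.
  replace (bform A e2 e2 * _ - _ + _) with
    (r * r' / mu ^ 2 * (bform A e2 e2 * (t * t') + mu * bform A e1 e2 * (t + t')
       + mu ^ 2 * bform A e1 e1)) in E by (field; lra).
  rewrite H, Rmult_0_r in E.
  apply Rmult_integral in E as [E | E]; [|assumption].
  apply pow_nonzero in E; [contradiction | lra].
Qed.

End ChordCoordinate.

(** * Orbit estimates for three forms in normal form *)

Section ThreeForms.

Variables (P Q C : pt) (F : R -> R) (e1 e2 mu k c : R).
Hypotheses (HP : in_D P) (HQ : in_D Q) (HC : in_D C).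
Hypothesis Fcont : continuity F.
Hypothesis Fstep : forall x, x < F x < x + 1.
Hypothesis Fper : forall x, F (x + 1) = F x + 1.
Hypotheses (SP : supports F P) (SQ : supports F Q) (SC : supports F C).
Hypothesis He : e1 < e2 < e1 + 1.
Hypothesis Hmu : 0 < mu.
Hypotheses (Hk : 0 < k < / 9) (Hc : k < c < 1).
Hypotheses (HP12 : bform P e1 e2 = 0) (HQ12 : bform Q e1 e2 = 0).
Hypothesis HPd : mu ^ 2 * bform P e1 e1 = k * bform P e2 e2.
Hypothesis HQd : k * (mu ^ 2 * bform Q e1 e1) = bform Q e2 e2.
Hypothesis HCd : mu ^ 2 * bform C e1 e1 = bform C e2 e2.
Hypothesis HC12 : mu * bform C e1 e2 = c * bform C e2 e2.

Let L := angle_of e1 e2 mu.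

(** The equation says that [t'] is the projection of [t] through [A]. If [t' < t], the projection
    has passed the end [e2], where the coordinate is infinite, and the integer part grows by one. *)
Lemma step_bound A t t' (m : Z) x :
  in_D A -> supports F A ->
  bform A e2 e2 * (t * t') + mu * bform A e1 e2 * (t + t') + mu ^ 2 * bform A e1 e1 = 0 ->
  x <= L t + IZR m ->
  (t < t' -> F x <= L t' + IZR m) /\ (t' < t -> F x <= L t' + IZR (m + 1)).
Proof.
  intros HA SA Hf Hx.
  apply (bform_angle_of e1 e2 mu He Hmu) in Hf; fold L in Hf.
  pose proof (lift_shift F Fper (- m) x) as E; rewrite opp_IZR in E.
  pose proof (Fstep (x + - IZR m)).
  pose proof (SA (x + - IZR m)).
  split; intros Ht.
  - enough (F (x + - IZR m) <= L t') by lra.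
    pose proof (angle_of_lt e1 e2 mu He Hmu _ _ Ht).
    apply (bform_compare A (x + - IZR m) _ (L t)); auto; lra.
  - rewrite plus_IZR.
    enough (F (x + - IZR m) <= L t' + 1) by lra.
    pose proof (angle_of_range e1 e2 mu t) as R1; pose proof (angle_of_range e1 e2 mu t') as R2.
    fold L in R1, R2.
    apply (bform_compare A (x + - IZR m) _ (L t)); auto; try lra.
    (* A full turn negates the half-angle vector, so the zero persists. *)
    enough (bform A (L t) (L t' + 1) = - bform A (L t) (L t')) by lra.
    unfold bform; rewrite !Rmult_plus_distr_l, !Rmult_1_r, !neg_cos, !neg_sin; ring.
Qed.

Lemma step_P t m x : t <> 0 -> x <= L t + IZR m ->
  (t < 0 -> F x <= L (- k / t) + IZR m) /\ (0 < t -> F x <= L (- k / t) + IZR (m + 1)).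
Proof.
  intros Ht Hx.
  destruct (step_bound P t (- k / t) m x HP SP) as [H1 H2]; [|assumption|].
  { rewrite HP12, HPd; field; assumption. }
  split; intros Hs; [apply H1 | apply H2].
  - apply Rlt_trans with 0; [assumption|].
    apply Rdiv_neg_neg; lra.
  - apply Rlt_trans with 0; [|assumption].
    apply Rdiv_neg_pos; lra.
Qed.

Lemma step_Q t m x : 0 < t -> x <= L t + IZR m ->
  F x <= L (- / (k * t)) + IZR (m + 1).
Proof.
  intros Ht Hx.
  destruct (step_bound Q t (- / (k * t)) m x HQ SQ) as [_ H2]; [|assumption|].
  { rewrite HQ12, <- HQd; field; lra. }
  apply H2.
  assert (0 < / (k * t)) by (apply Rinv_0_lt_compat; nra); lra.
Qed.

Lemma step_C t m x : t + c <> 0 -> x <= L t + IZR m ->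
  (t + c < 0 -> F x <= L (- (1 + c * t) / (t + c)) + IZR m) /\
  (0 < t + c -> F x <= L (- (1 + c * t) / (t + c)) + IZR (m + 1)).
Proof.
  intros Ht Hx.
  destruct (step_bound C t (- (1 + c * t) / (t + c)) m x HC SC) as [H1 H2]; [|assumption|].
  { rewrite HC12, HCd; field; assumption. }
  (* Positive since [c ^ 2 < 1]; hence the sign of [t' - t] is opposite to that of [t + c]. *)
  assert (Hq : 0 < 1 + 2 * c * t + t ^ 2) by nra.
  assert (E : - (1 + c * t) / (t + c) - t = - (1 + 2 * c * t + t ^ 2) / (t + c))
    by (field; assumption).
  split; intros Hs; [apply H1 | apply H2].
  - enough (0 < - (1 + c * t) / (t + c) - t) by lra.
    rewrite E; apply Rdiv_neg_neg; lra.
  - enough (- (1 + c * t) / (t + c) - t < 0) by lra.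
    rewrite E; apply Rdiv_neg_pos; lra.
Qed.

(** Only the step through [Q] crosses infinity: [k * t <= k < c] makes the coordinate after [C]
    negative, and [P] then makes it positive. *)
Lemma step_QCP t x : 0 < t <= 1 -> x <= L t ->
  Nat.iter 3 F x <= L (k * (1 - c * k * t) / (c - k * t)) + 1.
Proof.
  intros Ht Hx; simpl Nat.iter.
  assert (Hkt : 0 < k * t <= k) by nra.
  assert (Hckt : 0 < c * k * t < 1) by nra.
  assert (H1 : F x <= L (- / (k * t)) + 1).
  { apply (step_Q t 0); simpl; lra. }
  assert (Hinv : 1 < / (k * t)) by (rewrite <- Rinv_1; apply Rinv_lt_contravar; lra).
  set (t2 := (k * t - c) / (1 - c * k * t)).
  assert (H2 : F (F x) <= L t2 + 1).
  { replace t2 with (- (1 + c * (- / (k * t))) / (- / (k * t) + c)).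
    - apply (step_C (- / (k * t)) 1); lra.
    - unfold t2; field; split; [|split]; nra. }
  assert (Ht2 : t2 < 0) by (apply Rdiv_neg_pos; lra).
  replace (k * (1 - c * k * t) / (c - k * t)) with (- k / t2).
  - apply (step_P t2 1); lra.
  - unfold t2; field; lra.
Qed.

Lemma orbit_QCPQC t x : 0 < t <= / 2 -> x <= L t -> Nat.iter 5 F x < L t + 2.
Proof.
  intros Ht Hx.
  pose proof (step_QCP t x ltac:(lra) Hx) as H3.
  change (Nat.iter 5 F x) with (F (F (Nat.iter 3 F x))).
  set (w := Nat.iter 3 F x) in *.
  assert (Hkt : 0 < k * t <= k / 2) by nra.
  assert (Hckt : 0 < c * k * t < 1) by nra.
  set (t3 := k * (1 - c * k * t) / (c - k * t)) in *.
  assert (Ht3 : 0 < t3) by (apply Rdiv_lt_0_compat; nra).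
  pose proof (step_Q t3 1 w Ht3 H3) as H4; simpl in H4.
  replace (- / (k * t3)) with (- (c - k * t) / (k ^ 2 * (1 - c * k * t))) in H4
    by (unfold t3; field; lra).
  set (t4 := - (c - k * t) / (k ^ 2 * (1 - c * k * t))) in *.
  set (d := c - k * t - c * k ^ 2 * (1 - c * k * t)).
  assert (Hd : 0 < d).
  { unfold d.
    assert (0 <= c * k ^ 2) by (apply Rmult_le_pos; nra).
    assert (c * k ^ 2 * (1 - c * k * t) <= c * k ^ 2) by nra.
    assert (k ^ 2 < / 81) by nra.
    assert (c * k ^ 2 <= c * / 81) by (apply Rmult_le_compat_l; lra); lra. }
  assert (E : t4 + c = - d / (k ^ 2 * (1 - c * k * t))) by (unfold t4, d; field; lra).
  assert (Hden : 0 < k ^ 2 * (1 - c * k * t)) by (apply Rmult_lt_0_compat; nra).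
  assert (H4c : t4 + c < 0) by (rewrite E; apply Rdiv_neg_pos; lra).
  destruct (step_C t4 2 (F w) ltac:(lra) H4) as [H5 _]; specialize (H5 H4c).
  apply Rle_lt_trans with (1 := H5); apply Rplus_lt_compat_r.
  apply (angle_of_lt e1 e2 mu He Hmu).
  replace (- (1 + c * t4) / (t4 + c))
    with ((k ^ 2 * (1 - c * k * t) - c * (c - k * t)) / d).
  2: { unfold d, t4; field; repeat split; try lra; unfold d in Hd; lra. }
  apply Rmult_lt_reg_r with d; [assumption|].
  unfold Rdiv; rewrite Rmult_assoc, Rinv_l, Rmult_1_r by lra.
  (* This is [t * d] minus the numerator. The bracket is positive because [k * t < c / 2] for
     [t <= 1/2], while [k < 1/9] makes [(1 - k) * (1 - k ^ 2)] exceed 1/2. *)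
  assert (Hq : 0 < (c ^ 2 - k ^ 2) + t * (c * ((1 - k) * (1 - k ^ 2)) - k * t * (1 - c ^ 2 * k ^ 2))).
  { assert (/ 2 < (1 - k) * (1 - k ^ 2)) by nra.
    assert (c * / 2 < c * ((1 - k) * (1 - k ^ 2))) by nra.
    assert (0 <= c ^ 2 * k ^ 2) by nra.
    assert (k * t * (1 - c ^ 2 * k ^ 2) <= k * / 2) by nra.
    assert (0 < t * (c * ((1 - k) * (1 - k ^ 2)) - k * t * (1 - c ^ 2 * k ^ 2)))
      by (apply Rmult_lt_0_compat; lra).
    nra. }
  unfold d; nra.
Qed.

Lemma orbit_QCPCP t x : / 2 <= t <= 1 -> x <= L t -> Nat.iter 5 F x < L t + 2.
Proof.
  intros Ht Hx.
  pose proof (step_QCP t x ltac:(lra) Hx) as H3.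
  change (Nat.iter 5 F x) with (F (F (Nat.iter 3 F x))).
  set (w := Nat.iter 3 F x) in *.
  assert (Hkt : 0 < k * t <= k) by nra.
  assert (Hckt : 0 < c * k * t < 1) by nra.
  set (t3 := k * (1 - c * k * t) / (c - k * t)) in *.
  assert (Ht3 : 0 < t3) by (apply Rdiv_lt_0_compat; nra).
  (* As [t3 > 0], this projection through [C] makes the second crossing of infinity; the last one,
     through [P], makes none. *)
  destruct (step_C t3 1 w ltac:(lra) H3) as [_ H4]; specialize (H4 ltac:(lra)); simpl in H4.
  set (n := c - k * t + c * k * (1 - c * k * t)).
  assert (Hn : 0 < n) by (unfold n; nra).
  set (d := k * (1 - c * k * t) + c * (c - k * t)).
  assert (Hd : 0 < d) by (unfold d; nra).
  replace (- (1 + c * t3) / (t3 + c)) with (- n / d) in H4.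
  2: { unfold n, t3, d; field; repeat split; try lra; unfold d in Hd; nra. }
  assert (Ht4 : - n / d < 0) by (apply Rdiv_neg_pos; lra).
  destruct (step_P (- n / d) 2 (F w) ltac:(lra) H4) as [H5 _]; specialize (H5 Ht4).
  apply Rle_lt_trans with (1 := H5); apply Rplus_lt_compat_r.
  apply (angle_of_lt e1 e2 mu He Hmu).
  replace (- k / (- n / d)) with (k * d / n) by (field; lra).
  apply Rmult_lt_reg_r with n; [assumption|].
  unfold Rdiv; rewrite Rmult_assoc, Rinv_l, Rmult_1_r by lra.
  (* The difference is a concave quadratic in [t], positive at [1/2] and [1]. *)
  set (q := fun t => - k * (k + c ^ 2) + c * ((1 + k) * (1 + k ^ 2)) * t - k * (1 + c ^ 2 * k) * t ^ 2).
  assert (Hq1 : 0 < q 1).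
  { replace (q 1) with ((1 + k) * ((c - k) * (1 - c * k))) by (unfold q; ring).
    repeat apply Rmult_lt_0_compat; nra. }
  assert (Hq2 : 0 < q (/ 2)).
  { replace (q (/ 2)) with (c * ((1 + k) * (1 + k ^ 2)) / 2 - k * (1 / 4 + k + c ^ 2 * (1 + k / 4)))
      by (unfold q; field).
    assert (c ^ 2 <= c) by nra.
    assert (k * k < / 9 * c) by nra.
    assert (k * c ^ 2 * (1 + k / 4) <= / 9 * c * (37 / 36)) by nra.
    assert (c * 1 <= c * ((1 + k) * (1 + k ^ 2))) by (apply Rmult_le_compat_l; nra).
    nra. }
  assert (Hq : 0 < q t).
  (* Linear interpolation between 1/2 and 1, plus a remainder that concavity makes nonnegative. *)
  { replace (q t) with ((2 * t - 1) * q 1 + (2 - 2 * t) * q (/ 2)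
       + k * (1 + c ^ 2 * k) * ((1 - t) * (t - / 2))) by (unfold q; field).
    assert (0 <= k * (1 + c ^ 2 * k) * ((1 - t) * (t - / 2))).
    { apply Rmult_le_pos; [apply Rmult_le_pos|apply Rmult_le_pos]; nra. }
    nra. }
  unfold q in Hq; unfold d, n; nra.
Qed.

Lemma three_forms_rot_number_lt : rot_number F < 2 / 5.
Proof.
  apply (rot_number_lt F Fcont Fstep Fper (L 0) (L 1)).
  - apply angle_of_lt; lra.
  - intros x Hx.
    destruct (angle_of_surj e1 e2 mu He Hmu x) as [t Ht].
    { pose proof (angle_of_range e1 e2 mu 0); pose proof (angle_of_range e1 e2 mu 1).
      unfold L in Hx; lra. }
    fold L in Ht; subst x.
    assert (0 < t).
    { apply Rnot_le_lt; intros [H | H].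
      - apply (angle_of_lt e1 e2 mu He Hmu) in H; fold L in H; lra.
      - subst t; lra. }
    assert (t <= 1).
    { apply Rnot_lt_le; intros H'.
      apply (angle_of_lt e1 e2 mu He Hmu) in H'; fold L in H'; lra. }
    destruct (Rle_dec t (/ 2)).
    + apply orbit_QCPQC; lra.
    + apply orbit_QCPCP; lra.
  - intros x Hx.
    (* [step_QCP] needs a positive coordinate, and its bound is at most 1 once [k * (1 + t) <= c];
       [t = c - k] satisfies this because [k < 1]. *)
    assert (H : L 0 < L (c - k)) by (apply angle_of_lt; lra).
    pose proof (step_QCP (c - k) x ltac:(lra) ltac:(lra)) as H3.
    apply Rle_trans with (1 := H3); apply Rplus_le_compat_r.
    set (t3 := k * _ / _).
    assert (Ht3 : t3 <= 1).
    { assert (0 < c - k * (c - k)) by nra.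
      apply Rmult_le_reg_r with (c - k * (c - k)); [assumption|].
      unfold t3, Rdiv; rewrite Rmult_assoc, Rinv_l by lra.
      assert (0 <= k * (c * k * (c - k))) by (repeat apply Rmult_le_pos; lra).
      nra. }
    destruct Ht3 as [Ht3 | ->]; [|lra].
    left; now apply (angle_of_lt e1 e2 mu He Hmu).
Qed.

End ThreeForms.

(** * Chord endpoints and the hyperbolic distance *)

Lemma ch_a_pos P Q : P <> Q -> 0 < ch_a P Q.
Proof.
  destruct P as [p1 p2], Q as [q1 q2]; unfold ch_a; simpl fst; simpl snd; intros H.
  destruct (Req_dec (q1 - p1) 0) as [H1 | H1]; destruct (Req_dec (q2 - p2) 0) as [H2 | H2].
  - exfalso; apply H; f_equal; lra.
  - pose proof (pow2_gt_0 _ H2); pose proof (pow2_ge_0 (q1 - p1)); lra.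
  - pose proof (pow2_gt_0 _ H1); pose proof (pow2_ge_0 (q2 - p2)); lra.
  - pose proof (pow2_gt_0 _ H1); pose proof (pow2_ge_0 (q2 - p2)); lra.
Qed.

(** The quadratic is negative at [0] and at [1], since [P] and [Q] lie inside the circle, so its
    roots enclose both. *)
Lemma chord_roots P Q : in_D P -> in_D Q -> P <> Q ->
  ch_a P Q * (s_minus P Q + s_plus P Q) = - 2 * ch_b P Q /\
  ch_a P Q * (s_minus P Q * s_plus P Q) = ch_c P /\
  s_minus P Q < 0 /\ 1 < s_plus P Q.
Proof.
  intros HP HQ Hne.
  pose proof (ch_a_pos P Q Hne) as Ha.
  assert (Hc : ch_c P < 0) by (unfold ch_c, in_D in *; lra).
  assert (Hq : ch_a P Q + 2 * ch_b P Q + ch_c P < 0).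
  { unfold in_D in HQ; unfold ch_a, ch_b, ch_c; nra. }
  assert (Hd : 0 < ch_b P Q ^ 2 - ch_a P Q * ch_c P) by nra.
  unfold s_minus, s_plus.
  set (a := ch_a P Q) in *; set (b := ch_b P Q) in *; set (c := ch_c P) in *.
  pose proof (sqrt_lt_R0 _ Hd) as Hs; pose proof (sqrt_sqrt _ (Rlt_le _ _ Hd)) as Hss.
  set (r := sqrt _) in *.
  assert (Hbr : - b - r < 0) by nra.
  assert (Har : a + b < r) by nra.
  repeat split.
  - field; lra.
  - replace c with ((b * b - r * r) / a); [field; lra|].
    rewrite Hss; field; lra.
  - apply Rdiv_neg_pos; lra.
  - apply Rmult_lt_reg_r with a; [assumption|].
    unfold Rdiv; rewrite Rmult_assoc, Rinv_l by lra; lra.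
Qed.

Lemma edist_lin_l P Q s : edist (lin P Q s) P = Rabs s * sqrt (ch_a P Q).
Proof.
  unfold edist, lin, ch_a; simpl fst; simpl snd.
  rewrite <- sqrt_Rsqr_abs, <- sqrt_mult_alt by apply Rle_0_sqr.
  f_equal; unfold Rsqr; ring.
Qed.

Lemma edist_lin_r P Q s : edist (lin P Q s) Q = Rabs (s - 1) * sqrt (ch_a P Q).
Proof.
  unfold edist, lin, ch_a; simpl fst; simpl snd.
  rewrite <- sqrt_Rsqr_abs, <- sqrt_mult_alt by apply Rle_0_sqr.
  f_equal; unfold Rsqr; ring.
Qed.

Lemma dprime_neq P Q : P <> Q -> dprime P Q = dprime_raw P Q.
Proof.
  intros H; unfold dprime.
  destruct (Req_EM_T _ _) as [E1|]; [|reflexivity].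
  destruct (Req_EM_T _ _) as [E2|]; [|reflexivity].
  exfalso; apply H; destruct P, Q; simpl in *; now subst.
Qed.

Lemma dprime_refl P : dprime P P = 0.
Proof.
  unfold dprime.
  destruct (Req_EM_T _ _) as [|H]; [|now destruct H].
  destruct (Req_EM_T _ _) as [|H]; [reflexivity|now destruct H].
Qed.

Lemma pt_eq_dec (P Q : pt) : P = Q \/ P <> Q.
Proof.
  destruct P as [a b], Q as [c d].
  destruct (Req_dec a c) as [-> | H]; [destruct (Req_dec b d) as [-> | H]|].
  - now left.
  - right; intros E; inversion E; auto.
  - right; intros E; inversion E; auto.
Qed.

Lemma dprime_ge_0 P Q : 0 <= dprime P Q.
Proof.
  destruct (pt_eq_dec P Q) as [<- | H].
  - rewrite dprime_refl; lra.
  - rewrite (dprime_neq P Q H); unfold dprime_raw.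
    apply Rmult_le_pos; [lra | apply Rabs_pos].
Qed.

(* This is [cosh (dprime P Q) ^ 2 = (1 - <P,Q>)^2 / ((1 - |P|^2) (1 - |Q|^2))]. *)
Lemma dprime_cosh P Q : in_D P -> in_D Q ->
  (exp (2 * dprime P Q) + 1) ^ 2
    * ((1 - (fst P ^ 2 + snd P ^ 2)) * (1 - (fst Q ^ 2 + snd Q ^ 2)))
  = 4 * exp (2 * dprime P Q) * (1 - (fst P * fst Q + snd P * snd Q)) ^ 2.
Proof.
  intros HP HQ.
  destruct (pt_eq_dec P Q) as [<- | Hne].
  { rewrite dprime_refl, Rmult_0_r, exp_0; ring. }
  destruct (chord_roots P Q HP HQ Hne) as [Hsum [Hprod [Hm Hp]]].
  pose proof (ch_a_pos P Q Hne) as Ha.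
  pose proof (sqrt_lt_R0 _ Ha) as Hsa.
  rewrite (dprime_neq P Q Hne); unfold dprime_raw, chord_end1, chord_end2.
  rewrite !edist_lin_l, !edist_lin_r.
  assert (Hb : ch_b P Q + ch_c P = - (1 - (fst P * fst Q + snd P * snd Q)))
    by (unfold ch_b, ch_c; ring).
  assert (Hc : ch_c P = - (1 - (fst P ^ 2 + snd P ^ 2))) by (unfold ch_c; ring).
  assert (Hq : ch_a P Q + 2 * ch_b P Q + ch_c P = - (1 - (fst Q ^ 2 + snd Q ^ 2)))
    by (unfold ch_a, ch_b, ch_c; ring).
  set (m := s_minus P Q) in *; set (p := s_plus P Q) in *.
  set (a := ch_a P Q) in *; set (L := sqrt a) in *.
  rewrite (Rabs_left (m - 1)), (Rabs_left m), (Rabs_right (p - 1)), (Rabs_right p) by lra.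
  (* The cross-ratio with [P] and [Q] at parameters [0] and [1]; it equals
     [exp (2 * dprime P Q)]. *)
  set (X := (1 - m) * p / ((- m) * (p - 1))).
  replace (- (m - 1) * L * (p * L) / (- m * L * ((p - 1) * L))) with X
    by (unfold X; field; lra).
  assert (Hden : 0 < - m * (p - 1)) by (apply Rmult_lt_0_compat; lra).
  assert (HX : 1 < X).
  { apply Rmult_lt_reg_r with (- m * (p - 1)); [assumption|].
    unfold X, Rdiv; rewrite Rmult_assoc, Rinv_l by lra; nra. }
  assert (HlX : 0 <= ln X) by (rewrite <- ln_1; left; apply ln_increasing; lra).
  rewrite Rabs_right by lra.
  replace (2 * (/ 2 * ln X)) with (ln X) by field.
  rewrite exp_ln by lra.
  replace ((X + 1) ^ 2) with ((m + p - 2 * (m * p)) ^ 2 / (- m * (p - 1)) ^ 2)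
    by (unfold X; field; lra).
  replace (1 - (fst P * fst Q + snd P * snd Q)) with (a * (m + p - 2 * (m * p)) / 2) by lra.
  replace (1 - (fst P ^ 2 + snd P ^ 2)) with (- (a * (m * p))) by lra.
  replace (1 - (fst Q ^ 2 + snd Q ^ 2)) with (a * ((1 - m) * (p - 1))) by lra.
  unfold X; field; lra.
Qed.

Lemma delta_le P Q C S : on_chord P Q S -> delta P Q C <= dprime C S.
Proof.
  intros HS; unfold delta.
  set (E := fun x => exists S, on_chord P Q S /\ x = dprime C S).
  destruct (Glb_Rbar_correct E) as [Hlb Hglb].
  pose proof (Hlb (dprime C S) (ex_intro _ S (conj HS eq_refl))) as H1.
  (* With [H1], this rules out an infinite infimum, on which [real] would return [0]. *)
  assert (H2 : Rbar_le 0 (Glb_Rbar E)).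
  { apply Hglb; intros x [T [_ ->]]; apply dprime_ge_0. }
  destruct (Glb_Rbar E) as [l | |]; simpl in *; easy.
Qed.

Lemma on_circle_circ v : on_circle v -> exists e, v = circ e.
Proof.
  destruct v as [a b]; unfold on_circle; simpl fst; simpl snd; intros H.
  pose proof PI_RGT_0.
  assert (Ha : -1 <= a <= 1) by nra.
  assert (Hb : sqrt (1 - Rsqr a) = Rabs b).
  { rewrite <- sqrt_Rsqr_abs; f_equal; unfold Rsqr; lra. }
  destruct (Rle_dec 0 b) as [Hs | Hs].
  - exists (acos a / (2 * PI)); unfold circ.
    replace (2 * PI * (acos a / (2 * PI))) with (acos a) by (field; lra).
    now rewrite cos_acos, sin_acos, Hb, Rabs_right by lra.
  - exists (- acos a / (2 * PI)); unfold circ.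
    replace (2 * PI * (- acos a / (2 * PI))) with (- acos a) by (field; lra).
    rewrite cos_neg, sin_neg, cos_acos, sin_acos, Hb, Rabs_left by lra.
    f_equal; ring.
Qed.

Lemma chord_end_on_circle P Q s :
  ch_a P Q * s ^ 2 + 2 * ch_b P Q * s + ch_c P = 0 -> on_circle (lin P Q s).
Proof.
  unfold on_circle, lin, ch_a, ch_b, ch_c; simpl; intros H; lra.
Qed.

Lemma bform_lin A B s x y :
  bform (lin A B s) x y = (1 - s) * bform A x y + s * bform B x y.
Proof. unfold bform, lin; simpl; ring. Qed.

(** On the circle the determinant vanishes, and the form degenerates to a product of two linear
    factors. *)
Lemma bform_circ e x y :
  bform (circ e) x y = 2 * (sin (PI * (x - e)) * sin (PI * (y - e))).
Proof.
  rewrite circ_half_angle, !sin_pi_minus; unfold bform; simpl.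
  pose proof (cos_sin_pi_sqr e) as H.
  set (c := cos (PI * e)) in *; set (s := sin (PI * e)) in *.
  replace (1 + (1 - 2 * (s * s))) with (2 * (c * c)) by lra.
  ring.
Qed.

Lemma chord_angles P Q : in_D P -> in_D Q -> P <> Q ->
  exists e1 e2, e1 < e2 < e1 + 1 /\ bform P e1 e2 = 0 /\ bform Q e1 e2 = 0.
Proof.
  intros HP HQ Hne.
  destruct (chord_roots P Q HP HQ Hne) as [Hsum [Hprod [Hm Hp]]].
  pose proof (ch_a_pos P Q Hne) as Ha.
  set (m := s_minus P Q) in *; set (p := s_plus P Q) in *.
  destruct (on_circle_circ (lin P Q m)) as [e1 He1].
  { apply chord_end_on_circle.
    replace (2 * ch_b P Q) with (- (ch_a P Q * (m + p))) by lra; rewrite <- Hprod; ring. }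
  destruct (on_circle_circ (lin P Q p)) as [e2' He2'].
  { apply chord_end_on_circle.
    replace (2 * ch_b P Q) with (- (ch_a P Q * (m + p))) by lra; rewrite <- Hprod; ring. }
  assert (Hdiff : lin P Q m <> lin P Q p).
  { intros E; unfold lin in E; injection E as E1 E2.
    unfold ch_a in Ha.
    assert ((p - m) * (fst Q - fst P) = 0) by lra.
    assert ((p - m) * (snd Q - snd P) = 0) by lra.
    assert (fst Q - fst P = 0) by nra.
    assert (snd Q - snd P = 0) by nra.
    nra. }
  destruct (integer_translate (e1 - e2')) as [n Hn].
  set (e2 := e2' + IZR n).
  assert (He2 : lin P Q p = circ e2) by (unfold e2; now rewrite circ_integer).
  exists e1, e2.
  assert (Hz1 : bform (lin P Q m) e1 e2 = 0).
  { rewrite He1, bform_circ, Rminus_diag, Rmult_0_r, sin_0; ring. }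
  assert (Hz2 : bform (lin P Q p) e1 e2 = 0).
  { rewrite He2, bform_circ, Rminus_diag, Rmult_0_r, sin_0; ring. }
  rewrite bform_lin in Hz1, Hz2.
  (* The form is affine along the line and vanishes at the two parameters [m] and [p], hence on the
     whole line. *)
  assert (HzP : (p - m) * bform P e1 e2 = 0) by nra.
  assert (HzQ : (p - m) * bform Q e1 e2 = 0) by nra.
  repeat split.
  - destruct (Req_dec e1 e2) as [E | E]; [|unfold e2 in *; lra].
    exfalso; apply Hdiff; congruence.
  - unfold e2; lra.
  - apply Rmult_integral in HzP; lra.
  - apply Rmult_integral in HzQ; lra.
Qed.

Lemma in_D_lin P Q s : in_D P -> in_D Q -> 0 < s < 1 -> in_D (lin P Q s).
Proof.
  unfold in_D, lin; destruct P as [a b], Q as [c d]; simpl fst; simpl snd; intros HP HQ Hs.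
  assert (E : (a + s * (c - a)) ^ 2 + (b + s * (d - b)) ^ 2 =
    (1 - s) * (a ^ 2 + b ^ 2) + s * (c ^ 2 + d ^ 2)
    - s * (1 - s) * ((c - a) ^ 2 + (d - b) ^ 2)) by ring.
  assert (0 <= s * (1 - s) * ((c - a) ^ 2 + (d - b) ^ 2)) 
    by (apply Rmult_le_pos; [nra | apply Rplus_le_le_0_compat; apply pow2_ge_0]).
  nra.
Qed.

(** [dprime_cosh] with its inner products replaced by [bform_det] and [bform_polar]; the mixed terms
    vanish because [A] is on the chord. *)
Lemma dprime_bform A B e1 e2 :
  e1 < e2 < e1 + 1 -> in_D A -> in_D B -> bform A e1 e2 = 0 ->
  (exp (2 * dprime A B) + 1) ^ 2
    * (bform A e2 e2 * bform A e1 e1 * (bform B e2 e2 * bform B e1 e1 - bform B e1 e2 ^ 2))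
  = exp (2 * dprime A B)
    * (bform A e2 e2 * bform B e1 e1 + bform A e1 e1 * bform B e2 e2) ^ 2.
Proof.
  intros He HA HB H0.
  pose proof (dprime_cosh A B HA HB) as H.
  pose proof (bform_polar A B e1 e2) as Hp.
  pose proof (bform_det A e1 e2) as HdA.
  pose proof (bform_det B e1 e2) as HdB.
  rewrite H0 in Hp, HdA.
  set (sg := sin (PI * (e2 - e1)) ^ 2) in *.
  rewrite HdB.
  replace (bform A e2 e2 * bform A e1 e1) with (sg * (1 - (fst A ^ 2 + snd A ^ 2))) by lra.
  replace (bform A e2 e2 * bform B e1 e1 + bform A e1 e1 * bform B e2 e2)
    with (2 * (sg * (1 - (fst A * fst B + snd A * snd B)))) by lra.
  transitivity (sg ^ 2 * ((exp (2 * dprime A B) + 1) ^ 2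
    * ((1 - (fst A ^ 2 + snd A ^ 2)) * (1 - (fst B ^ 2 + snd B ^ 2))))); [ring|].
  rewrite H; ring.
Qed.

(** [dprime_cosh] is symmetric and determines [exp (2 * dprime A B)] up to inversion; both
    exponentials are at least 1. *)
Lemma dprime_sym A B : in_D A -> in_D B -> dprime A B = dprime B A.
Proof.
  intros HA HB.
  pose proof (dprime_cosh A B HA HB) as H1; pose proof (dprime_cosh B A HB HA) as H2.
  pose proof (dprime_ge_0 A B) as G1; pose proof (dprime_ge_0 B A) as G2.
  set (N := (1 - (fst A ^ 2 + snd A ^ 2)) * (1 - (fst B ^ 2 + snd B ^ 2))) in *.
  assert (HN : 0 < N) by (unfold N, in_D in *; apply Rmult_lt_0_compat; lra).
  assert (Hexp : forall x, 0 <= x -> 1 <= exp (2 * x)).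
  { intros x Hx; pose proof (exp_ineq1_le (2 * x)); lra. }
  pose proof (Hexp _ G1) as X1; pose proof (Hexp _ G2) as X2.
  enough (E : exp (2 * dprime A B) = exp (2 * dprime B A)) by (apply exp_inv in E; lra).
  set (x := exp (2 * dprime A B)) in *; set (y := exp (2 * dprime B A)) in *.
  replace ((1 - (fst B ^ 2 + snd B ^ 2)) * (1 - (fst A ^ 2 + snd A ^ 2))) with N in H2
    by (unfold N; ring).
  replace (1 - (fst B * fst A + snd B * snd A))
    with (1 - (fst A * fst B + snd A * snd B)) in H2 by ring.
  set (M := (1 - (fst A * fst B + snd A * snd B)) ^ 2) in *.
  assert (E : N * ((x - y) * (x * y - 1)) = 0).
  { assert (E : y * ((x + 1) ^ 2 * N) = x * ((y + 1) ^ 2 * N)) by (rewrite H1, H2; ring).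
    lra. }
  apply Rmult_integral in E as [E | E]; [lra|].
  apply Rmult_integral in E as [E | E]; [lra|].
  nra.
Qed.

(** * Normal form of an isosceles triangle *)

Section Isosceles.

Variables (P Q C : pt) (F : R -> R) (e1 e2 : R).
Hypotheses (HP : in_D P) (HQ : in_D Q) (HC : in_D C).
Hypothesis Fcont : continuity F.
Hypothesis Fstep : forall x, x < F x < x + 1.
Hypothesis Fper : forall x, F (x + 1) = F x + 1.
Hypotheses (SP : supports F P) (SQ : supports F Q) (SC : supports F C).
Hypothesis He : e1 < e2 < e1 + 1.
Hypotheses (HP12 : bform P e1 e2 = 0) (HQ12 : bform Q e1 e2 = 0).
Hypothesis Hiso : dprime P C = dprime Q C.
Hypothesis Hlong : dprime P Q > ln 9.
Hypothesis Hfar : forall s, 0 < s < 1 -> dprime C (lin P Q s) > / 2 * Deltap 1 P Q.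
Hypothesis Horder :
  bform P e1 e1 * bform Q e2 e2 < bform P e2 e2 * bform Q e1 e1.

Lemma normal_form : exists mu k,
  0 < mu /\ 0 < k < / 9 /\ k * exp (dprime P Q) = 1 /\
  mu ^ 2 * bform P e1 e1 = k * bform P e2 e2 /\
  k * (mu ^ 2 * bform Q e1 e1) = bform Q e2 e2 /\
  mu ^ 2 * bform C e1 e1 = bform C e2 e2.
Proof.
  pose proof (bform_diag_pos P e1 HP) as Hp2; pose proof (bform_diag_pos P e2 HP) as Hp1.
  pose proof (bform_diag_pos Q e1 HQ) as Hq2; pose proof (bform_diag_pos Q e2 HQ) as Hq1.
  pose proof (bform_diag_pos C e1 HC) as Hc2; pose proof (bform_diag_pos C e2 HC) as Hc1.
  pose proof (dprime_bform P Q e1 e2 He HP HQ HP12) as EPQ.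
  pose proof (dprime_bform P C e1 e2 He HP HC HP12) as EPC.
  pose proof (dprime_bform Q C e1 e2 He HQ HC HQ12) as EQC.
  rewrite <- Hiso in EQC.
  rewrite HQ12 in EPQ.
  pose proof (exp_pos (2 * dprime P C)) as HE1.
  pose proof (bform_det C e1 e2) as HdC.
  assert (Hdet : 0 < bform C e2 e2 * bform C e1 e1 - bform C e1 e2 ^ 2).
  { rewrite HdC; apply Rmult_lt_0_compat; [|unfold in_D in HC; lra].
    apply pow_lt, sin_pi_pos; lra. }
  assert (He9 : 9 < exp (dprime P Q)).
  { rewrite <- (exp_ln 9) by lra; apply exp_increasing; lra. }
  replace (2 * dprime P Q) with (dprime P Q + dprime P Q) in EPQ by ring.
  rewrite exp_plus in EPQ.
  set (e := exp (dprime P Q)) in *.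
  set (p1 := bform P e2 e2) in *; set (p2 := bform P e1 e1) in *.
  set (q1 := bform Q e2 e2) in *; set (q2 := bform Q e1 e1) in *.
  set (c1 := bform C e2 e2) in *; set (c2 := bform C e1 e1) in *.
  set (c3 := bform C e1 e2) in *.
  set (E1 := exp (2 * dprime P C)) in *.
  (* The distance fixes the ratio of these products up to inversion, and [Horder] selects the value
     above 1. *)
  assert (HXY : p1 * q2 = e * e * (p2 * q1)).
  { assert (Hf : (p1 * q2 - e * e * (p2 * q1)) * (e * e * (p1 * q2) - p2 * q1) = 0) by lra.
    apply Rmult_integral in Hf as [Hf | Hf]; [lra|].
    assert (0 < p1 * q2) by (apply Rmult_lt_0_compat; assumption).
    assert (1 < e * e) by nra.
    nra. }
  set (k := / e).
  assert (Hk : 0 < k < / 9).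
  { unfold k; split; [apply Rinv_0_lt_compat; lra | apply Rinv_lt_contravar; lra]. }
  assert (Hke : k * e = 1) by (unfold k; field; lra).
  assert (Hm2 : 0 < k * p1 / p2) by (apply Rdiv_lt_0_compat; nra).
  (* This scale makes the diagonal ratios of [P] and [Q] reciprocal, [k] and [1/k]. *)
  set (mu := sqrt (k * p1 / p2)).
  assert (Hmm : mu ^ 2 = k * p1 / p2) by (unfold mu; simpl; rewrite Rmult_1_r; apply sqrt_sqrt; lra).
  assert (HPd : mu ^ 2 * p2 = k * p1) by (rewrite Hmm; field; lra).
  assert (HQd : k * (mu ^ 2 * q2) = q1).
  { rewrite Hmm.
    replace (k * (k * p1 / p2 * q2)) with (k * k * (p1 * q2) / p2) by (field; lra).
    rewrite HXY; unfold k; field; lra. }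
  exists mu, k; repeat split; try assumption; try lra.
  { apply sqrt_lt_R0; assumption. }
  assert (Hmp : 0 < mu ^ 2) by lra.
  set (M := mu ^ 2) in *.
  (* The two equal distances to [C] share [E1] and the determinant of [C]; eliminating both leaves
     only diagonal values. *)
  assert (Hcomp : q1 * q2 * (p1 * c2 + p2 * c1) ^ 2 = p1 * p2 * (q1 * c2 + q2 * c1) ^ 2).
  { set (dt := c1 * c2 - c3 ^ 2) in *.
    apply Rmult_eq_reg_l with E1; [|lra].
    transitivity (q1 * q2 * (E1 * (p1 * c2 + p2 * c1) ^ 2)); [ring|].
    rewrite <- EPC.
    transitivity (p1 * p2 * (E1 * (q1 * c2 + q2 * c1) ^ 2)); [rewrite <- EQC; ring | ring]. }
  rewrite <- HQd in Hcomp.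
  assert (Hp2e : p2 = k * p1 / M) by (rewrite <- HPd; field; lra).
  rewrite Hp2e in Hcomp.
  assert (Hsq : (M * c2 + k * c1) ^ 2 = (k * M * c2 + c1) ^ 2).
  { apply Rmult_eq_reg_l with (k * q2 ^ 2 * p1 ^ 2 / M).
    - transitivity (k * (M * q2) * q2 * (p1 * c2 + k * p1 / M * c1) ^ 2); [field; lra|].
      rewrite Hcomp; field; lra.
    - apply Rgt_not_eq, Rdiv_lt_0_compat; [|assumption].
      repeat apply Rmult_lt_0_compat; lra. }
  (* A difference of squares, in which only the factor [M * c2 - c1] can vanish. *)
  assert (Hf : (1 - k) * (M * c2 - c1) * ((1 + k) * (M * c2 + c1)) = 0) by lra.
  assert (0 < M * c2) by (apply Rmult_lt_0_compat; assumption).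
  apply Rmult_integral in Hf as [Hf | Hf]; [apply Rmult_integral in Hf as [Hf | Hf]; lra|].
  apply Rmult_integral in Hf as [Hf | Hf]; lra.
Qed.

Lemma ordered_rot_number_lt : rot_number F < 2 / 5.
Proof.
  destruct normal_form as [mu [k [Hmu [Hk [Hke [HPd [HQd HCd]]]]]]].
  pose proof (bform_diag_pos P e1 HP) as Hp2; pose proof (bform_diag_pos P e2 HP) as Hp1.
  pose proof (bform_diag_pos Q e1 HQ) as Hq2; pose proof (bform_diag_pos Q e2 HQ) as Hq1.
  pose proof (bform_diag_pos C e1 HC) as Hc2; pose proof (bform_diag_pos C e2 HC) as Hc1.
  pose proof (bform_det C e1 e2) as HdC.
  assert (Hdet : 0 < bform C e2 e2 * bform C e1 e1 - bform C e1 e2 ^ 2).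
  { rewrite HdC; apply Rmult_lt_0_compat; [|unfold in_D in HC; lra].
    apply pow_lt, sin_pi_pos; lra. }
  set (c := mu * bform C e1 e2 / bform C e2 e2).
  assert (Hcd : mu * bform C e1 e2 = c * bform C e2 e2) by (unfold c; field; lra).
  assert (Hmp : 0 < mu ^ 2) by (apply pow_lt; assumption).
  assert (HcC : bform C e1 e2 ^ 2 = c ^ 2 * bform C e2 e2 * bform C e1 e1).
  { apply Rmult_eq_reg_l with (mu ^ 2); [|lra].
    transitivity ((mu * bform C e1 e2) ^ 2); [ring|].
    rewrite Hcd.
    transitivity (c ^ 2 * bform C e2 e2 * (mu ^ 2 * bform C e1 e1)); [rewrite HCd; ring|ring]. }
  assert (Hcc : 0 < bform C e2 e2 * bform C e1 e1) by (apply Rmult_lt_0_compat; assumption).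
  assert (Hc_1 : c ^ 2 < 1) by nra.
  assert (Hk_c : k ^ 2 < c ^ 2).
  (* The parameter at which the two diagonal values agree after scaling: the hyperbolic midpoint of
     [P] and [Q]. *)
  { set (s := bform P e2 e2 / (bform P e2 e2 + mu ^ 2 * bform Q e1 e1)).
    assert (Hmq : 0 < mu ^ 2 * bform Q e1 e1) by (apply Rmult_lt_0_compat; assumption).
    assert (Hs : 0 < s < 1).
    { split; [apply Rdiv_lt_0_compat; lra|].
      apply Rmult_lt_reg_r with (bform P e2 e2 + mu ^ 2 * bform Q e1 e1); [lra|].
      unfold s, Rdiv; rewrite Rmult_assoc, Rinv_l by lra; lra. }
    assert (HS : in_D (lin P Q s)) by (apply in_D_lin; assumption).
    pose proof (Hfar s Hs) as Hd.
    rewrite (dprime_sym C (lin P Q s) HC HS) in Hd.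
    set (S := lin P Q s) in *.
    assert (HS12 : bform S e1 e2 = 0) by (unfold S; rewrite bform_lin, HP12, HQ12; ring).
    assert (HSd : mu ^ 2 * bform S e1 e1 = bform S e2 e2).
    { unfold S; rewrite !bform_lin.
      transitivity ((1 - s) * (mu ^ 2 * bform P e1 e1) + s * (mu ^ 2 * bform Q e1 e1)); [ring|].
      rewrite HPd, <- HQd; unfold s; field; lra. }
    pose proof (dprime_bform S C e1 e2 He HS HC HS12) as E.
    pose proof (bform_diag_pos S e1 HS) as Hs2.
    set (E2 := exp (2 * dprime S C)) in *.
    (* [exp (Deltap 1 P Q)] equals [(1 + k) / (1 - k)]. *)
    assert (HE2 : 1 + k < (1 - k) * E2).
    { assert (Hlt : exp (Deltap 1 P Q) < E2) by (apply exp_increasing; lra).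
      unfold Deltap in Hlt; simpl INR in Hlt; rewrite Rmult_1_l in Hlt.
      set (e := exp (dprime P Q)) in *.
      assert (He9 : 9 < e) by nra.
      rewrite exp_ln in Hlt by (apply Rdiv_lt_0_compat; lra).
      replace ((e + 1) / (e - 1)) with ((1 + k) / (1 - k)) in Hlt.
      - apply Rmult_lt_compat_l with (r := 1 - k) in Hlt; [|lra].
        replace ((1 - k) * ((1 + k) / (1 - k))) with (1 + k) in Hlt by (field; lra).
        assumption.
      - replace k with (/ e) by (apply Rmult_eq_reg_r with e; [rewrite Hke; field|]; lra).
        field; lra. }
    rewrite HcC, <- HSd, <- HCd in E.
    (* That is, [|c|] is the hyperbolic tangent of [dprime S C], and [HE2] says that this tangent
       exceeds [k]. *)
    assert (Hsq : (E2 - 1) ^ 2 = c ^ 2 * (E2 + 1) ^ 2).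
    { apply Rmult_eq_reg_l with ((mu ^ 2) * (bform S e1 e1) ^ 2 * (mu ^ 2 * bform C e1 e1 ^ 2)).
      - lra.
      - apply Rgt_not_eq; repeat apply Rmult_lt_0_compat; try assumption; try lra. }
    assert (Hgap : k * (E2 + 1) < E2 - 1) by lra.
    assert (0 < E2) by apply exp_pos.
    assert (Hsq' : (k * (E2 + 1)) ^ 2 < (E2 - 1) ^ 2).
    { assert (0 < k * (E2 + 1)) by (apply Rmult_lt_0_compat; lra); nra. }
    rewrite Hsq, Rpow_mult_distr in Hsq'.
    apply Rmult_lt_reg_r with ((E2 + 1) ^ 2); [apply pow_lt; lra | assumption]. }
  destruct (Rlt_dec 0 c) as [Hpos | Hneg].
  - apply (three_forms_rot_number_lt P Q C F e1 e2 mu k c); try assumption.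
    split; nra.
  - (* A quarter turn in the half-angle plane exchanges the chord endpoints,
       hence the roles of [P] and [Q], and changes the sign of [c]. *)
    assert (Hsh : forall A, bform A (e1 + 1) (e1 + 1) = bform A e1 e1)
      by (intros; apply bform_shift).
    assert (Hsh' : forall A, bform A e2 (e1 + 1) = - bform A e1 e2).
    { intros A; unfold bform.
      rewrite !Rmult_plus_distr_l, !Rmult_1_r, !neg_cos, !neg_sin; ring. }
    apply (three_forms_rot_number_lt Q P C F e2 (e1 + 1) (/ mu) k (- c)); try assumption;
      rewrite ?Hsh, ?Hsh'.
    + lra.
    + now apply Rinv_0_lt_compat.
    + split; nra.
    + lra.
    + lra.
    + rewrite <- HQd; field; lra.
    + replace (bform P e2 e2) with (mu ^ 2 * bform P e1 e1 / k) by (rewrite HPd; field; lra).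
      field; lra.
    + rewrite <- HCd; field; lra.
    + replace (bform C e1 e2) with (c * bform C e2 e2 / mu) by (rewrite <- Hcd; field; lra).
      rewrite <- HCd; field; lra.
Qed.

End Isosceles.

(** * From the triangle to the forms, by the order of [P] and [Q] on the chord *)

Theorem theorem6p17 (P Q C : pt) (F : R -> R) :
  in_D P -> in_D Q -> in_D C ->
  dprime P C = dprime Q C ->
  dprime P Q > ln 9 ->
  delta P Q C > / 2 * Deltap 1%nat P Q ->
  is_lift_psi (filled_triangle P Q C) F ->
  rot_number F < 2 / 5.
Proof.
  intros HP HQ HC Hiso Hlong Hdelta HF.
  assert (Hln : 0 < ln 9) by (rewrite <- ln_1; apply ln_increasing; lra).
  assert (Hne : P <> Q) by (intros ->; rewrite dprime_refl in Hlong; lra).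
  destruct (chord_angles P Q HP HQ Hne) as [e1 [e2 [He [HP12 HQ12]]]].
  destruct (chord_roots P Q HP HQ Hne) as [_ [_ [Hm Hp]]].
  assert (Hfar : forall s, 0 < s < 1 -> dprime C (lin P Q s) > / 2 * Deltap 1 P Q).
  { intros s Hs; apply Rlt_le_trans with (1 := Hdelta), delta_le.
    exists s; split; [lra | reflexivity]. }
  destruct (lift_supports P Q C F HF) as [SP [SQ SC]].
  pose proof (lift_step P Q C F HF) as Fstep.
  pose proof (lift_periodic P Q C F HP HQ HC HF) as Fper.
  assert (Fcont : continuity F) by apply HF.
  destruct (Rtotal_order (bform P e1 e1 * bform Q e2 e2) (bform P e2 e2 * bform Q e1 e1))
    as [Hlt | [Heq | Hgt]].
  - now apply (ordered_rot_number_lt P Q C F e1 e2).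
  (* Equality would force [exp (2 * dprime P Q) = 1]. *)
  - exfalso.
    pose proof (dprime_bform P Q e1 e2 He HP HQ HP12) as E.
    rewrite HQ12 in E.
    set (x := exp (2 * dprime P Q)) in *.
    assert (Hx : 1 < x) by (unfold x; pose proof (exp_ineq1_le (2 * dprime P Q)); lra).
    assert (0 < bform P e2 e2 * bform Q e1 e1)
      by (apply Rmult_lt_0_compat; now apply bform_diag_pos).
    set (X := bform P e2 e2 * bform Q e1 e1) in *.
    replace (bform P e2 e2 * bform P e1 e1 * (bform Q e2 e2 * bform Q e1 e1 - 0 ^ 2))
      with (X * (bform P e1 e1 * bform Q e2 e2)) in E by (unfold X; ring).
    rewrite Heq in E.
    assert (E' : X ^ 2 * (x - 1) ^ 2 = 0) by lra.
    apply Rmult_integral in E' as [E' | E']; nra.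
  - apply (ordered_rot_number_lt Q P C F e1 e2); try assumption.
    + now symmetry.
    + now rewrite dprime_sym.
    + intros s Hs.
      replace (lin Q P s) with (lin P Q (1 - s))
        by (unfold lin; f_equal; ring).
      unfold Deltap; rewrite (dprime_sym Q P HQ HP).
      apply Hfar; lra.
    + lra.
Qed.
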